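(* Let $c_0$ be a proper $4$-colouring of the plane, let $\mu$ be a left-invariant finitely additive probability measure on $S_4\times E(2)$, and let $p_d$ be the associated monochromaticity probabilities (see context). Then $$p_{\frac{\sqrt6-\sqrt2}{2}}\ge\frac{13}{150}.$$
   Context: Identify the plane with $\mathbb C$. A proper $4$-colouring of the plane is a map $c_0:\mathbb C\to\{1,2,3,4\}$ such that no two points at distance $1$ have the same colour. Let $S_4$ be the group of permutations of the colours and $E(2)$ the group of Euclidean isometries of the plane. The group $S_4\times E(2)$ is amenable, so there is a finitely additive probability measure $\mu$ defined on all subsets of $S_4\times E(2)$ which is left-invariant, i.e. $\mu(gE)=\mu(E)$ for all $g\in S_4\times E(2)$ and $E\subseteq S_4\times E(2)$. For $(\sigma,T)\in S_4\times E(2)$ consider the (random) colouring $c=\sigma\circ c_0\circ T^{-1}$. For $d\ge 0$, $p_d$ denotes the probability that two points $A,B$ at distance $d$ get the same colour: $p_d=\mu(\{(\sigma,T): c(A)=c(B)\})$; by left-invariance this does not depend on the choice of $A,B$ with $|AB|=d$. The existence of $c_0$ is a standing assumption, and $c_0,\mu$ are arbitrary but fixed. *)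

(* Defs.v *)
From HB Require Import structures.
From mathcomp Require Import all_boot all_order all_algebra all_fingroup.
From mathcomp Require Import boolp classical_sets reals.
From mathcomp Require Import complex.

Set Implicit Arguments.
Unset Strict Implicit.
Unset Printing Implicit Defensive.

Import Order.TTheory GRing.Theory Num.Theory.

Local Open Scope ring_scope.
Local Open Scope complex_scope.
Local Open Scope classical_set_scope.

(* The plane is R[i], with R the real numbers.  Its norm `|z| takes values in
   R[i], so a distance d : R appears below as d%:C.

   Distance-preserving self-maps of the plane are automatically bijective; the
   inverse is kept as data so that it is available without choice. *)
Record isometry (R : realType) := Isometry {
  iso_fun :> R[i] -> R[i];
  iso_inv : R[i] -> R[i];
  iso_funK : cancel iso_fun iso_inv;
  iso_invK : cancel iso_inv iso_fun;
  iso_dist : forall x y, `|iso_fun x - iso_fun y| = `|x - y|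
}.

Lemma isometryP (R : realType) (S T : isometry R) :
  (forall z, S z = T z) -> S = T.
Proof.
case: S T => [f f' fK f'K fd] [g g' gK g'K gd] /= fg.
have {}fg : f = g by apply/funext.
have fg' : f' = g' by apply/funext => z; rewrite -{1}(g'K z) -fg fK.
subst g g'.
by rewrite (Prop_irrelevance fK gK) (Prop_irrelevance f'K g'K)
  (Prop_irrelevance fd gd).
Qed.

Section IsometryGroup.
Variable R : realType.
Implicit Types S T U : isometry R.

Definition iso_one : isometry R :=
  @Isometry R id id (fun=> erefl) (fun=> erefl) (fun _ _ => erefl).

Lemma iso_mul_dist S T x y : `|(S \o T) x - (S \o T) y| = `|x - y|.
Proof. by rewrite /= !iso_dist. Qed.

Definition iso_mul S T : isometry R :=
  @Isometry R (S \o T) (iso_inv T \o iso_inv S)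
    (can_comp (iso_funK S) (iso_funK T)) (can_comp (iso_invK T) (iso_invK S))
    (iso_mul_dist S T).

Lemma iso_inverse_dist T x y : `|iso_inv T x - iso_inv T y| = `|x - y|.
Proof. by rewrite -(iso_dist T) !iso_invK. Qed.

Definition iso_inverse T : isometry R :=
  @Isometry R (iso_inv T) T (iso_invK T) (iso_funK T) (iso_inverse_dist T).

Lemma iso_mulA : associative iso_mul.
Proof. by move=> S T U; apply: isometryP. Qed.

Lemma iso_mul1 : left_id iso_one iso_mul.
Proof. by move=> T; apply: isometryP. Qed.

Lemma iso_1mul : right_id iso_one iso_mul.
Proof. by move=> T; apply: isometryP. Qed.

Lemma iso_mulV : left_inverse iso_one iso_inverse iso_mul.
Proof. by move=> T; apply: isometryP => z; apply: iso_funK. Qed.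

Lemma iso_Vmul : right_inverse iso_one iso_inverse iso_mul.
Proof. by move=> T; apply: isometryP => z; apply: iso_invK. Qed.

End IsometryGroup.

HB.instance Definition _ (R : realType) := gen_eqMixin (isometry R).
HB.instance Definition _ (R : realType) := gen_choiceMixin (isometry R).
HB.instance Definition _ (R : realType) :=
  isGroup.Build (isometry R) (@iso_mulA R) (@iso_mul1 R) (@iso_1mul R)
    (@iso_mulV R) (@iso_Vmul R).

(* The group S_4 x E(2).  It is not the library product of groups: the product
   s * t of {perm 'I_4} is "s, then t", whereas here both components are
   multiplied by composition of functions. *)
Record S4E2 (R : realType) := SymIso {
  col_perm : {perm 'I_4};
  plane_iso : isometry R
}.

Section S4E2Group.
Variable R : realType.
Implicit Types g h k : S4E2 R.

Definition s4e2_one : S4E2 R := SymIso 1%g 1%g.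

Definition s4e2_mul g h : S4E2 R :=
  SymIso (col_perm h * col_perm g)%g (plane_iso g * plane_iso h)%g.

Definition s4e2_inv g : S4E2 R := SymIso (col_perm g)^-1%g (plane_iso g)^-1%g.

Lemma s4e2_mulA : associative s4e2_mul.
Proof. by move=> g h k; rewrite /s4e2_mul /= !mulgA. Qed.

Lemma s4e2_mul1 : left_id s4e2_one s4e2_mul.
Proof. by case=> s T; rewrite /s4e2_mul /= mulg1 mul1g. Qed.

Lemma s4e2_1mul : right_id s4e2_one s4e2_mul.
Proof. by case=> s T; rewrite /s4e2_mul /= mulg1 mul1g. Qed.

Lemma s4e2_mulV : left_inverse s4e2_one s4e2_inv s4e2_mul.
Proof. by case=> s T; rewrite /s4e2_mul /= mulgV mulVg. Qed.

Lemma s4e2_Vmul : right_inverse s4e2_one s4e2_inv s4e2_mul.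
Proof. by case=> s T; rewrite /s4e2_mul /= mulgV mulVg. Qed.

End S4E2Group.

HB.instance Definition _ (R : realType) := gen_eqMixin (S4E2 R).
HB.instance Definition _ (R : realType) := gen_choiceMixin (S4E2 R).
HB.instance Definition _ (R : realType) :=
  isGroup.Build (S4E2 R) (@s4e2_mulA R) (@s4e2_mul1 R) (@s4e2_1mul R)
    (@s4e2_mulV R) (@s4e2_Vmul R).

Record left_invariant_mean (R : realType) (G : groupType) (mu : set G -> R) :
    Prop := LeftInvariantMean {
  mean_ge0 : forall E, 0 <= mu E;
  mean_setT : mu setT = 1;
  mean_setU : forall E F, E `&` F = set0 -> mu (E `|` F) = mu E + mu F;
  mean_mulg : forall (g : G) E, mu [set (g * h)%g | h in E] = mu E
}.

Definition proper_colouring (R : realType) (c : R[i] -> 'I_4) : Prop :=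
  forall A B, `|A - B| = 1 -> c A <> c B.

Definition colouring_of (R : realType) (c0 : R[i] -> 'I_4) (g : S4E2 R) :
    R[i] -> 'I_4 :=
  fun z => col_perm g (c0 ((plane_iso g)^-1%g z)).

Definition same_colour (R : realType) (c0 : R[i] -> 'I_4) (A B : R[i]) :
    set (S4E2 R) :=
  [set g | colouring_of c0 g A = colouring_of c0 g B].

(* The probability p_d, read off the points 0 and d; mono_probE shows that any
   two points at distance d give the same value. *)
Definition mono_prob (R : realType) (c0 : R[i] -> 'I_4)
    (mu : set (S4E2 R) -> R) (d : R) : R :=
  mu (same_colour c0 0 d%:C).

Section MonoProb.
Variable R : realType.
Variables (c0 : R[i] -> 'I_4) (mu : set (S4E2 R) -> R).

Lemma colouring_ofM (g h : S4E2 R) z :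
  colouring_of c0 (g * h)%g z =
  col_perm g (colouring_of c0 h ((plane_iso g)^-1%g z)).
Proof. by rewrite /colouring_of /= permM. Qed.

Lemma same_colour_mulg (g : S4E2 R) A B :
  [set (g * h)%g | h in same_colour c0 A B] =
  same_colour c0 (plane_iso g A) (plane_iso g B).
Proof.
apply/seteqP; split => [_ [h /= AB <-]|k /= AB].
  by rewrite /same_colour /= !colouring_ofM /= !iso_funK AB.
exists (g^-1 * k)%g; last by rewrite mulgA mulgV mul1g.
by rewrite /same_colour /= !colouring_ofM /= AB.
Qed.

Lemma transl_rot_exists (d A B : R[i]) : `|A - B| = `|d| ->
  exists T : isometry R, T 0 = A /\ T d = B.
Proof.
move=> ABd.
have [u u1 ud] : exists2 u : R[i], `|u| = 1 & u * d = B - A.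
  have [d0|d0] := eqVneq d 0.
    exists 1; first exact: normr1.
    by apply/eqP; rewrite d0 mulr0 eq_sym -normr_eq0 distrC ABd d0 normr0.
  exists ((B - A) / d); last by rewrite divfK.
  by rewrite normf_div distrC ABd divff // normr_eq0.
have u0 : u != 0 by rewrite -normr_eq0 u1 oner_eq0.
have fK : cancel (fun z => A + u * z) (fun z => u^-1 * (z - A)).
  by move=> z; rewrite addrC addKr mulKf.
have f'K : cancel (fun z => u^-1 * (z - A)) (fun z => A + u * z).
  by move=> z; rewrite mulVKf // addrC subrK.
have fd x y : `|(A + u * x) - (A + u * y)| = `|x - y|.
  by rewrite opprD addrACA subrr add0r -mulrBr normrM u1 mul1r.
exists (Isometry fK f'K fd) => /=; split; first by rewrite mulr0 addr0.
by rewrite ud addrC subrK.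
Qed.

Lemma mono_probE (d : R) (A B : R[i]) : left_invariant_mean mu ->
  `|A - B| = d%:C -> mu (same_colour c0 A B) = mono_prob c0 mu d.
Proof.
move=> mu_inv ABd.
have /transl_rot_exists[T [T0 Td]] : `|A - B| = `|d%:C|.
  by rewrite -ABd normr_id.
rewrite /mono_prob -(mean_mulg mu_inv (SymIso 1%g T) (same_colour c0 0 _)).
by rewrite same_colour_mulg /= T0 Td.
Qed.

End MonoProb.

(* Main.v *)
Require Import Defs.
From mathcomp Require Import all_boot all_order all_algebra all_fingroup.
From mathcomp Require Import boolp classical_sets reals.
From mathcomp Require Import complex ring lra.

Set Implicit Arguments.
Unset Strict Implicit.
Unset Printing Implicit Defensive.

Import Order.TTheory GRing.Theory Num.Theory.

Local Open Scope ring_scope.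

(** Put [w = exp(i pi/6)].  Around the origin, the four points [1, w, w^2, w^3]
    use three colours, and [1, w^2] as well as [w, w^3] are at distance 1; hence
    two consecutive points agree, or [1] and [w^3] do.  The consecutive
    distances are [d = (sqrt 6 - sqrt 2) / 2] and [|1 - w^3| = sqrt 2], so
    [3 p_d + p_(sqrt 2) >= 1].  In a triangle with sides [sqrt 2, sqrt 2, 1] the
    apex agrees with at most one end of the base, so [p_(sqrt 2) <= 1/2].
    Together, [p_d >= 1/6 > 13/150]. *)

Section LeftInvariantMean.
Local Open Scope classical_set_scope.
Variables (R : realType) (G : groupType) (mu : set G -> R).
Hypothesis hmu : left_invariant_mean mu.

Lemma mean_le (E F : set G) : E `<=` F -> mu E <= mu F.
Proof.
move=> EF; rewrite -(setDUK EF) (mean_setU hmu) ?setDIK //.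
by rewrite lerDl (mean_ge0 hmu).
Qed.

Lemma mean_setU_le (E F : set G) : mu (E `|` F) <= mu E + mu F.
Proof.
(* Removing [E] from [F] makes the union disjoint, so finite additivity applies. *)
have -> : E `|` F = E `|` (F `\` E).
  by apply/seteqP; split => x /=; have [] := pselect (E x); tauto.
rewrite (mean_setU hmu) ?setDIK // lerD2l; apply: mean_le.
exact: subDsetl.
Qed.

End LeftInvariantMean.

(** Reduces a distance to a polynomial identity in the coordinates; [0 <= d] selects the right
    square root. *)
Lemma dist_Complex (R : rcfType) (d x y x' y' : R) : 0 <= d ->
  (x - x') ^+ 2 + (y - y') ^+ 2 = d ^+ 2 ->
  `|Complex x y - Complex x' y'| = (d%:C)%C.
Proof. by move=> d0 e; rewrite normc_def /= e sqrtr_sqr ger0_norm. Qed.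

Lemma proper_colouring_of (R : realType) (c0 : R[i] -> 'I_4) (g : S4E2 R) :
  proper_colouring c0 -> proper_colouring (colouring_of c0 g).
Proof.
move=> hc0 A B AB /perm_inj; apply: hc0.
by rewrite (iso_dist (plane_iso g)^-1%g).
Qed.

(** If all four equalities failed, the five colours would be pairwise distinct in a set of four
    elements. *)
Lemma I4_coincidence (o a b c e : 'I_4) :
  o <> a -> o <> b -> o <> c -> o <> e -> a <> c -> b <> e ->
  [\/ a = b, b = c, c = e | a = e].
Proof.
move=> /eqP oa /eqP ob /eqP oc /eqP oe /eqP ac /eqP be.
case: (eqVneq a b) => [->|ab]; first by constructor 1.
case: (eqVneq b c) => [->|bc]; first by constructor 2.
case: (eqVneq c e) => [->|ce]; first by constructor 3.
case: (eqVneq a e) => [->|ae]; first by constructor 4.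
have /card_uniqP/= u : uniq [:: o; a; b; c; e].
  by rewrite /= !inE !negb_or oa ob oc oe ab ac ae bc be ce.
by have := max_card (mem [:: o; a; b; c; e]); rewrite u card_ord.
Qed.

Section MonoProbBounds.
Local Open Scope classical_set_scope.
Variables (R : realType) (c0 : R[i] -> 'I_4) (mu : set (S4E2 R) -> R).
Hypotheses (hc0 : proper_colouring c0) (hmu : left_invariant_mean mu).
Local Notation p := (mono_prob c0 mu).

Lemma isosceles_mono_prob_le (A B C : R[i]) (d : R) :
  `|A - B| = (d%:C)%C -> `|A - C| = (d%:C)%C -> `|B - C| = 1 -> p d <= 1 / 2.
Proof.
move=> AB AC BC.
have dis : same_colour c0 A B `&` same_colour c0 A C = set0.
  apply/seteqP; split => // g [cAB cAC].
  exact: (@proper_colouring_of _ _ g hc0 _ _ BC (etrans (esym cAB) cAC)).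
have := mean_le hmu (@subsetT _ (same_colour c0 A B `|` same_colour c0 A C)).
by rewrite (mean_setU hmu) // (mean_setT hmu) !(mono_probE _ hmu AB)
  !(mono_probE _ hmu AC); lra.
Qed.

Lemma mono_prob_sqrt2_le : p (Num.sqrt 2) <= 1 / 2.
Proof.
have s7 : Num.sqrt 7 ^+ 2 = 7 :> R by rewrite sqr_sqrtr.
have s2 : Num.sqrt 2 ^+ 2 = 2 :> R by rewrite sqr_sqrtr.
(* The height over the base of length 1: [x ^+ 2 = 2 - 1 / 4]. The apex is the origin and the base
   is vertical. *)
pose x : R := Num.sqrt 7 / 2.
apply: (isosceles_mono_prob_le (A := Complex 0 0)
  (B := Complex x (1 / 2)) (C := Complex x (- (1 / 2)))).
- by apply: dist_Complex; rewrite ?sqrtr_ge0 // s2 /x; nra.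
- by apply: dist_Complex; rewrite ?sqrtr_ge0 // s2 /x; nra.
- by apply: (@dist_Complex _ 1) => //; lra.
Qed.

Lemma wheel_mono_prob_ge (O A B C D : R[i]) (d r : R) :
  `|O - A| = 1 -> `|O - B| = 1 -> `|O - C| = 1 -> `|O - D| = 1 ->
  `|A - C| = 1 -> `|B - D| = 1 ->
  `|A - B| = (d%:C)%C -> `|B - C| = (d%:C)%C -> `|C - D| = (d%:C)%C ->
  `|A - D| = (r%:C)%C -> 1 <= p d *+ 3 + p r.
Proof.
move=> OA OB OC OD AC BD AB BC CD AD.
(* These four events may overlap, so only subadditivity is used below. *)
have cover : setT `<=` same_colour c0 A B `|` same_colour c0 B C
    `|` same_colour c0 C D `|` same_colour c0 A D.
  move=> g _; have hg := @proper_colouring_of _ _ g hc0.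
  have [] := I4_coincidence (hg _ _ OA) (hg _ _ OB) (hg _ _ OC) (hg _ _ OD)
    (hg _ _ AC) (hg _ _ BD); rewrite /same_colour /=; tauto.
have := mean_le hmu cover; rewrite (mean_setT hmu) => /le_trans; apply.
rewrite -(mono_probE c0 hmu AD).
apply: le_trans (mean_setU_le hmu _ _) _; rewrite lerD2r.
rewrite !mulrS addr0 addrA.
(* Each copy of [p d] becomes the measure of a different event of the union. *)
rewrite -{1}(mono_probE c0 hmu AB) -{1}(mono_probE c0 hmu BC).
rewrite -(mono_probE c0 hmu CD).
apply: le_trans (mean_setU_le hmu _ _) _; rewrite lerD2r.
exact: mean_setU_le.
Qed.

End MonoProbBounds.

Theorem mainTheorem4 (R : realType) (c0 : R[i] -> 'I_4)
    (mu : set (S4E2 R) -> R)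
    (hc0 : proper_colouring c0) (hmu : left_invariant_mean mu) :
  13 / 150 <= mono_prob c0 mu ((Num.sqrt 6 - Num.sqrt 2) / 2).
Proof.
set d := (Num.sqrt 6 - Num.sqrt 2) / 2.
have s2 : Num.sqrt 2 ^+ 2 = 2 :> R by rewrite sqr_sqrtr.
have s3 : Num.sqrt 3 ^+ 2 = 3 :> R by rewrite sqr_sqrtr.
have d0 : 0 <= d by rewrite divr_ge0 // subr_ge0 ler_sqrt // ler_nat.
(* This is [2 - 2 cos(pi/6)]: [d] is the chord of angle [pi/6] in the unit circle. *)
have d2 : d ^+ 2 = 2 - Num.sqrt 3.
  have s6 : Num.sqrt 6 = Num.sqrt 2 * Num.sqrt 3 :> R.
    by rewrite -sqrtrM //; congr Num.sqrt; rewrite -natrM.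
  rewrite /d s6.
  have -> : (Num.sqrt 2 * Num.sqrt 3 - Num.sqrt 2) / 2 =
    Num.sqrt 2 * ((Num.sqrt 3 - 1) / 2) :> R by field.
  by rewrite exprMn s2; nra.
(* [h] is both [cos(pi/6)] and [sin(pi/3)], so the rim points below are the powers of [w]. *)
pose h : R := Num.sqrt 3 / 2.
have wheel : 1 <= mono_prob c0 mu d *+ 3 + mono_prob c0 mu (Num.sqrt 2).
  apply: (@wheel_mono_prob_ge _ _ _ hc0 hmu (Complex 0 0) (Complex 1 0)
    (Complex h (1 / 2)) (Complex (1 / 2) h) (Complex 0 1)).
  (* In order: four radii and two chords of angle [pi/3], all of length 1; three chords of [pi/6];
     one chord of [pi/2]. *)
  1-6: by apply: (@dist_Complex _ 1) => //; rewrite /h; nra.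
  1-3: by apply: dist_Complex => //; rewrite d2 /h; nra.
  by apply: dist_Complex; rewrite ?sqrtr_ge0 // s2; lra.
have := mono_prob_sqrt2_le hc0 hmu.
move: wheel; rewrite -mulr_natr; lra.
Qed.
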